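(* Let $G\in\mathbb{R}^{(N_1+N_2)\times(N_1+N_2)}$ be an invertible matrix such that $HJG^{-1}$ is symmetric and positive definite. Let $\mathbf{p}(t)\in\mathbb{R}^{\hat N}$, $\mathbf{v}^1(t)\in\mathbb{R}^{N_1}$, $\mathbf{v}^2(t)\in\mathbb{R}^{N_2}$ be differentiable functions of $t\ge 0$ satisfying the semi-discrete system $$\hat J\,\frac{d\mathbf{p}}{dt}+\widehat D_1J_1\mathbf{v}^1+\widehat D_2J_2\mathbf{v}^2=0,\qquad \frac{d}{dt}\begin{bmatrix}\mathbf{v}^1\\ \mathbf{v}^2\end{bmatrix}+G\begin{bmatrix}D_1\mathbf{p}\\ D_2\mathbf{p}\end{bmatrix}=0 .$$ Assume that the grid metric and the solution are periodic in each direction. Then the energy $$\mathcal{E}(t)=\frac12\,\mathbf{p}^T\hat H\hat J\,\mathbf{p}+\frac12\begin{bmatrix}\mathbf{v}^1\\ \mathbf{v}^2\end{bmatrix}^T HJG^{-1}\begin{bmatrix}\mathbf{v}^1\\ \mathbf{v}^2\end{bmatrix}$$ is conserved, i.e. $\frac{d\mathcal{E}}{dt}=0$.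
   Context: Let $N\ge1$ be an integer, $\hat N=(N+2)(N+2)$, $N_1=(N+1)(N+2)$, $N_2=(N+2)(N+1)$, and let $\hat I$ be the $(N+2)\times(N+2)$ identity matrix. One-dimensional staggered SBP (summation-by-parts) operators: real matrices $D\in\mathbb{R}^{(N+1)\times(N+2)}$, $\hat D\in\mathbb{R}^{(N+2)\times(N+1)}$ and positive definite diagonal matrices $M\in\mathbb{R}^{(N+1)\times(N+1)}$, $\hat M\in\mathbb{R}^{(N+2)\times(N+2)}$ such that for all $\mathbf{u}=[u_0,\dots,u_N]^T$ and $\hat{\mathbf{v}}=[v_0,\dots,v_{N+1}]^T$, $$\mathbf{u}^TMD\hat{\mathbf{v}}=u_Nv_{N+1}-u_0v_0-(\hat D\mathbf{u})^T\hat M\hat{\mathbf{v}}.$$ Two-dimensional grid vectors: $\mathbf{p}=(p_{i,j})$, $0\le i,j\le N+1$; $\mathbf{v}^1=(v^1_{i,j})$, $0\le i\le N$, $0\le j\le N+1$; $\mathbf{v}^2=(v^2_{i,j})$, $0\le i\le N+1$, $0\le j\le N$; each is ordered with the second index $j$ varying fastest. Operators: $$D_1=D\otimes\hat I,\quad D_2=\hat I\otimes D,\quad \widehat D_1=\hat D\otimes\hat I,\quad \widehat D_2=\hat I\otimes\hat D,$$ $$H_1=M\otimes\hat M,\quad H_2=\hat M\otimes M,\quad \hat H=\hat M\otimes\hat M,\quad H=\begin{bmatrix}H_1&0\\0&H_2\end{bmatrix},\quad J=\begin{bmatrix}J_1&0\\0&J_2\end{bmatrix}.$$ Here $\hat J\in\mathbb{R}^{\hat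 N\times\hat N}$, $J_1\in\mathbb{R}^{N_1\times N_1}$, $J_2\in\mathbb{R}^{N_2\times N_2}$ are time-independent diagonal matrices with positive diagonal entries (the Jacobian of the curvilinear mapping evaluated at the grid points of $\mathbf{p}$, $\mathbf{v}^1$, $\mathbf{v}^2$ respectively, with entries indexed accordingly). $G$ is time-independent (a discrete approximation of the contravariant metric tensor). Periodicity in each direction means that values on opposite boundaries coincide: for all $t$, $p_{0,j}=p_{N+1,j}$, $p_{i,0}=p_{i,N+1}$, $v^1_{0,j}=v^1_{N,j}$, $v^2_{i,0}=v^2_{i,N}$, and likewise for the diagonal metric entries, $(J_1)_{0,j}=(J_1)_{N,j}$, $(J_2)_{i,0}=(J_2)_{i,N}$, for all admissible indices. Consequently the boundary terms produced by the SBP property in the two coordinate directions cancel. *)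

(* Defs.v *)
From mathcomp Require Import all_boot all_order all_algebra.
From mathcomp Require Import sesquilinear.
From mathcomp Require Import all_classical all_reals all_analysis.
From mathcomp.real_closed Require Export mxtens.

Set Implicit Arguments.
Unset Strict Implicit.
Unset Printing Implicit Defensive.

Import Order.TTheory GRing.Theory Num.Theory.
Import numFieldNormedType.Exports.

Local Open Scope classical_set_scope.
Local Open Scope ring_scope.

(* Derivative relative to the half-line [0, +oo[: the increment h is
   restricted to 0 <= t + h, so that this is the two-sided derivative for t > 0
   and the right derivative at t = 0; values f t with t < 0 are irrelevant. *)
Definition diff_quot (R : realType) (V : normedModType R) (f : R -> V)
    (t h : R) : V :=
  h^-1 *: (f (t + h) - f t).

Definition derivable_ge0 (R : realType) (V : normedModType R) (f : R -> V)
    (t : R) : Prop :=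
  cvg (diff_quot f t h @[h --> within [set h | 0 <= t + h] 0^']).

Definition ddt (R : realType) (V : normedModType R) (f : R -> V) (t : R) : V :=
  lim (diff_quot f t h @[h --> within [set h | 0 <= t + h] 0^']).

Definition posdefmx (R : realType) (n : nat) (A : 'M[R]_n) : Prop :=
  forall x : 'cV[R]_n, x != 0 -> 0 < (x^T *m A *m x) 0 0.

Definition sbp_operators (R : realType) (N : nat)
    (D : 'M[R]_(N.+1, N.+2)) (Dh : 'M[R]_(N.+2, N.+1))
    (M : 'M[R]_N.+1) (Mh : 'M[R]_N.+2) : Prop :=
  [/\ is_diag_mx M /\ posdefmx M,
      is_diag_mx Mh /\ posdefmx Mh
    & forall (u : 'cV[R]_N.+1) (v : 'cV[R]_N.+2),
        (u^T *m M *m D *m v) 0 0 =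
        u ord_max 0 * v ord_max 0 - u ord0 0 * v ord0 0
          - ((Dh *m u)^T *m Mh *m v) 0 0].

(* [A *t B] is the Kronecker product; [mxtens_index (i, j)], of value
   [i * n + j], is the position of the grid point (i, j), with j fastest. *)
Definition D1 (R : realType) (N : nat) (D : 'M[R]_(N.+1, N.+2))
    : 'M[R]_(N.+1 * N.+2, N.+2 * N.+2) :=
  D *t (1%:M : 'M[R]_N.+2).

Definition D2 (R : realType) (N : nat) (D : 'M[R]_(N.+1, N.+2))
    : 'M[R]_(N.+2 * N.+1, N.+2 * N.+2) :=
  (1%:M : 'M[R]_N.+2) *t D.

Definition Dh1 (R : realType) (N : nat) (Dh : 'M[R]_(N.+2, N.+1))
    : 'M[R]_(N.+2 * N.+2, N.+1 * N.+2) :=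
  Dh *t (1%:M : 'M[R]_N.+2).

Definition Dh2 (R : realType) (N : nat) (Dh : 'M[R]_(N.+2, N.+1))
    : 'M[R]_(N.+2 * N.+2, N.+2 * N.+1) :=
  (1%:M : 'M[R]_N.+2) *t Dh.

Definition H1 (R : realType) (N : nat) (M : 'M[R]_N.+1) (Mh : 'M[R]_N.+2)
    : 'M[R]_(N.+1 * N.+2) :=
  M *t Mh.

Definition H2 (R : realType) (N : nat) (M : 'M[R]_N.+1) (Mh : 'M[R]_N.+2)
    : 'M[R]_(N.+2 * N.+1) :=
  Mh *t M.

Definition Hh (R : realType) (N : nat) (Mh : 'M[R]_N.+2)
    : 'M[R]_(N.+2 * N.+2) :=
  Mh *t Mh.

Definition H (R : realType) (N : nat) (M : 'M[R]_N.+1) (Mh : 'M[R]_N.+2)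
    : 'M[R]_(N.+1 * N.+2 + N.+2 * N.+1) :=
  block_mx (H1 M Mh) 0 0 (H2 M Mh).

Definition pos_diag (R : realType) (n : nat) (A : 'M[R]_n) : Prop :=
  is_diag_mx A /\ forall i, 0 < A i i.

Definition periodic_dir1 (T : Type) (m n : nat) (f : 'I_(m.+1 * n) -> T)
    : Prop :=
  forall j : 'I_n,
    f (mxtens_index (ord0, j)) = f (mxtens_index (ord_max, j)).

Definition periodic_dir2 (T : Type) (m n : nat) (f : 'I_(m * n.+1) -> T)
    : Prop :=
  forall i : 'I_m,
    f (mxtens_index (i, ord0)) = f (mxtens_index (i, ord_max)).

Definition periodic_metric (R : realType) (N : nat)
    (J1 : 'M[R]_(N.+1 * N.+2)) (J2 : 'M[R]_(N.+2 * N.+1)) : Prop :=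
  periodic_dir1 (fun k => J1 k k) /\ periodic_dir2 (fun k => J2 k k).

Definition periodic_solution (R : realType) (N : nat)
    (p : 'cV[R]_(N.+2 * N.+2)) (v1 : 'cV[R]_(N.+1 * N.+2))
    (v2 : 'cV[R]_(N.+2 * N.+1)) : Prop :=
  [/\ periodic_dir1 (fun k => p k 0), periodic_dir2 (fun k => p k 0),
      periodic_dir1 (fun k => v1 k 0) & periodic_dir2 (fun k => v2 k 0)].

Definition energy (R : realType) (m n : nat) (Hh Jh : 'M[R]_m)
    (H J G : 'M[R]_n) (p : 'cV[R]_m) (v : 'cV[R]_n) : R :=
  2^-1 * (p^T *m (Hh *m Jh) *m p) 0 0
    + 2^-1 * (v^T *m (H *m J *m invmx G) *m v) 0 0.

(* Main.v *)
Require Import Defs.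
From mathcomp Require Import all_boot all_order all_algebra.
From mathcomp Require Import sesquilinear.
From mathcomp Require Import all_classical all_reals all_analysis.
Import Order.TTheory GRing.Theory Num.Theory.
Import numFieldNormedType.Exports.
Local Open Scope ring_scope.

(* With B = e_N e_{N+1}^T - e_0 e_0^T, the SBP property is the matrix identity
   M D + Dh^T Mh = B.  Since H1 and J1 are diagonal and G cancels, the two parts
   of dE/dt add up to - (J1 v1)^T (B (x) Mh) p - (J2 v2)^T (Mh (x) B) p, and each
   of these is a difference of the same bilinear form in the slices of the two
   vectors at opposite ends of the grid, which coincide by periodicity. *)

(** * Diagonal matrices, Kronecker products and slices of grid vectors *)

Lemma diag_mxC {R : comPzRingType} {n : nat} {A B : 'M[R]_n} :
  is_diag_mx A -> is_diag_mx B -> A *m B = B *m A.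
Proof.
move=> /diag_mxP[a ->] /diag_mxP[b ->]; rewrite !mulmx_diag.
by congr diag_mx; apply/rowP => i; rewrite !mxE mulrC.
Qed.

Lemma tr_is_diag {R : nmodType} {n : nat} {A : 'M[R]_n} :
  is_diag_mx A -> A^T = A.
Proof. by move=> /diag_mxP[a ->]; rewrite tr_diag_mx. Qed.

Lemma tensmx_is_diag {R : pzRingType} {m n : nat} {A : 'M[R]_m} {B : 'M[R]_n} :
  is_diag_mx A -> is_diag_mx B -> is_diag_mx (A *t B).
Proof.
move=> /is_diag_mxP dA /is_diag_mxP dB; apply/is_diag_mxP => k l.
case: (mxtens_indexP k) => i j; case: (mxtens_indexP l) => i' j'.
rewrite tensmxE; have [<-|ni _] := eqVneq i i'; last by rewrite dA ?mul0r.
by have [<-|nj _] := eqVneq j j'; rewrite ?eqxx // dB ?mulr0.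
Qed.

Lemma mul_is_diagE {R : pzSemiRingType} {n : nat} {A : 'M[R]_n} (x : 'cV[R]_n) k :
  is_diag_mx A -> (A *m x) k 0 = A k k * x k 0.
Proof. by move=> /diag_mxP[a ->]; rewrite mul_diag_mx !mxE eqxx mulr1n. Qed.

(** Only the term at grid index (i, l) survives in the sum: e_i^T (x) I restricts a grid vector to
    its slice of first index i. The index k ranges over ['I_1], since e_i^T has a single row. *)
Lemma tensmx_deltal {R : comPzRingType} {m n : nat} (i : 'I_m) (x : 'cV[R]_(m * n)) k l :
  (((delta_mx 0 i : 'rV[R]_m) *t (1%:M : 'M[R]_n)) *m x) (mxtens_index (k, l)) 0
  = x (mxtens_index (i, l)) 0.
Proof.
rewrite mxE (bigD1 (mxtens_index (i, l))) //= big1 => [|q].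
  by rewrite tensmxE !mxE !ord1 !eqxx !mul1r addr0.
case: (mxtens_indexP q) => i' l'; rewrite (can_eq (@mxtens_indexK _ _)) xpair_eqE.
by rewrite tensmxE !mxE ord1 eqxx eq_sym (eq_sym l');
  case: eqP => //=; case: eqP => //= *; rewrite ?(mulr0, mul0r).
Qed.

Lemma tensmx_deltar {R : comPzRingType} {m n : nat} (i : 'I_n) (x : 'cV[R]_(m * n)) k l :
  (((1%:M : 'M[R]_m) *t (delta_mx 0 i : 'rV[R]_n)) *m x) (mxtens_index (k, l)) 0
  = x (mxtens_index (k, i)) 0.
Proof.
rewrite mxE (bigD1 (mxtens_index (k, i))) //= big1 => [|q].
  by rewrite tensmxE !mxE !ord1 !eqxx !mul1r addr0.
case: (mxtens_indexP q) => k' i'; rewrite (can_eq (@mxtens_indexK _ _)) xpair_eqE.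
by rewrite tensmxE !mxE ord1 eqxx eq_sym (eq_sym i');
  case: eqP => //=; case: eqP => //= *; rewrite ?(mulr0, mul0r).
Qed.

(** * Boundary terms under periodicity *)

Definition boundary_mx (R : pzRingType) (m n : nat) : 'M[R]_(m.+1, n.+1) :=
  delta_mx ord_max ord_max - delta_mx ord0 ord0.

Lemma mul_delta_delta (R : pzSemiRingType) m n (i : 'I_m) (j : 'I_n) :
  (delta_mx 0 i : 'rV[R]_m)^T *m delta_mx 0 j = delta_mx i j.
Proof. by rewrite trmx_delta mul_delta_mx. Qed.

(** Each corner term e_i e_j^T (x) C factors as S_i^T (1 (x) C) S_j, where S_i extracts slice i and
    1 is the 1 x 1 identity. Periodicity makes the first and last slices equal, so the two corner
    terms of B contribute the same value with opposite signs. *)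
Lemma boundary_dir1_eq0 {R : comPzRingType} {m m' n : nat} (C : 'M[R]_n)
    {x : 'cV[R]_(m.+1 * n)} {y : 'cV[R]_(m'.+1 * n)} :
  periodic_dir1 (fun k => x k 0) -> periodic_dir1 (fun k => y k 0) ->
  x^T *m (boundary_mx R m m' *t C) *m y = 0.
Proof.
move=> px py.
pose S p i := (delta_mx 0 i : 'rV[R]_p.+1) *t (1%:M : 'M[R]_n).
have sliceP p (z : 'cV[R]_(p.+1 * n)) : periodic_dir1 (fun k => z k 0) ->
    S p ord_max *m z = S p ord0 *m z.
  move=> pz; apply/colP => k; case: (mxtens_indexP k) => a l.
  by rewrite !tensmx_deltal; exact/esym/pz.
have E i j : delta_mx i j *t C = (S m i)^T *m (1%:M *t C) *m S m' j.
  by rewrite /S trmx_tens !tensmx_mul trmx1 mulmx1 mul1mx mulmx1 mul_delta_delta.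
have -> : boundary_mx R m m' *t C =
    delta_mx ord_max ord_max *t C - delta_mx ord0 ord0 *t C.
  by apply/matrixP => k l; rewrite !mxE mulrBl.
rewrite !E mulmxBr mulmxBl !mulmxA -!trmx_mul -!(mulmxA _ _ y).
by rewrite (sliceP _ x px) (sliceP _ y py) subrr.
Qed.

Lemma boundary_dir2_eq0 {R : comPzRingType} {m n n' : nat} (C : 'M[R]_m)
    {x : 'cV[R]_(m * n.+1)} {y : 'cV[R]_(m * n'.+1)} :
  periodic_dir2 (fun k => x k 0) -> periodic_dir2 (fun k => y k 0) ->
  x^T *m (C *t boundary_mx R n n') *m y = 0.
Proof.
move=> px py.
pose S p i := (1%:M : 'M[R]_m) *t (delta_mx 0 i : 'rV[R]_p.+1).
have sliceP p (z : 'cV[R]_(m * p.+1)) : periodic_dir2 (fun k => z k 0) ->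
    S p ord_max *m z = S p ord0 *m z.
  move=> pz; apply/colP => k; case: (mxtens_indexP k) => a l.
  by rewrite !tensmx_deltar; exact/esym/pz.
have E i j : C *t delta_mx i j = (S n i)^T *m (C *t 1%:M) *m S n' j.
  by rewrite /S trmx_tens !tensmx_mul trmx1 !mulmx1 mul1mx mul_delta_delta.
have -> : C *t boundary_mx R n n' =
    C *t delta_mx ord_max ord_max - C *t delta_mx ord0 ord0.
  by apply/matrixP => k l; rewrite !mxE mulrBr.
rewrite !E mulmxBr mulmxBl !mulmxA -!trmx_mul -!(mulmxA _ _ y).
by rewrite (sliceP _ x px) (sliceP _ y py) subrr.
Qed.

(** * The SBP property as a matrix identity, in one and two dimensions *)

Lemma bilinear_mx_inj (R : pzSemiRingType) m n (A B : 'M[R]_(m, n)) :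
  (forall (u : 'cV_m) (v : 'cV_n), (u^T *m A *m v) 0 0 = (u^T *m B *m v) 0 0) ->
  A = B.
Proof.
move=> AB; apply/matrixP => i j; have := AB (delta_mx i 0) (delta_mx j 0).
by rewrite !trmx_delta -!rowE -!colE !mxE.
Qed.

Lemma bilinear_delta_mx (R : pzSemiRingType) m n (u : 'cV[R]_m) (v : 'cV[R]_n) i j :
  (u^T *m delta_mx i j *m v) 0 0 = u i 0 * v j 0.
Proof.
rewrite -(mul_delta_mx (0 : 'I_1)) mulmxA -colE -mulmxA -rowE.
by rewrite mxE big_ord1 !mxE.
Qed.

Lemma sbp_mx {R : realType} {N : nat} {D : 'M[R]_(N.+1, N.+2)}
    {Dh : 'M[R]_(N.+2, N.+1)} {M : 'M[R]_N.+1} {Mh : 'M[R]_N.+2} :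
  sbp_operators D Dh M Mh -> M *m D + Dh^T *m Mh = boundary_mx R N N.+1.
Proof.
case=> _ _ sbp; apply: bilinear_mx_inj => u v.
rewrite mulmxDr mulmxDl mxE !mulmxA sbp trmx_mul subrK.
by rewrite mulmxBr mulmxBl [RHS]mxE [X in _ = _ + X]mxE !bilinear_delta_mx.
Qed.

(** By the mixed product rule H1 D1 = (M D) (x) Mh and Dh1^T Hh = (Dh^T Mh) (x) Mh. Their sum is B
    (x) Mh, whose form vanishes on periodic vectors. *)
Lemma sbp_dir1 {R : realType} {N : nat} {D : 'M[R]_(N.+1, N.+2)}
    {Dh : 'M[R]_(N.+2, N.+1)} {M : 'M[R]_N.+1} {Mh : 'M[R]_N.+2}
    {w : 'cV[R]_(N.+1 * N.+2)} {p : 'cV[R]_(N.+2 * N.+2)} :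
  sbp_operators D Dh M Mh ->
  periodic_dir1 (fun k => w k 0) -> periodic_dir1 (fun k => p k 0) ->
  w^T *m (H1 M Mh *m D1 D) *m p = - ((Dh1 Dh *m w)^T *m Hh Mh *m p).
Proof.
move=> sbp pw pp; apply/eqP; rewrite -addr_eq0; apply/eqP.
rewrite trmx_mul -(mulmxA w^T (Dh1 Dh)^T) -mulmxDl -mulmxDr
  -[RHS](boundary_dir1_eq0 Mh pw pp).
rewrite /Dh1 trmx_tens !tensmx_mul mulmx1 trmx1 mul1mx -(sbp_mx sbp).
by congr (_ *m _ *m _); apply/matrixP => k l; rewrite !mxE mulrDl.
Qed.

Lemma sbp_dir2 {R : realType} {N : nat} {D : 'M[R]_(N.+1, N.+2)}
    {Dh : 'M[R]_(N.+2, N.+1)} {M : 'M[R]_N.+1} {Mh : 'M[R]_N.+2}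
    {w : 'cV[R]_(N.+2 * N.+1)} {p : 'cV[R]_(N.+2 * N.+2)} :
  sbp_operators D Dh M Mh ->
  periodic_dir2 (fun k => w k 0) -> periodic_dir2 (fun k => p k 0) ->
  w^T *m (H2 M Mh *m D2 D) *m p = - ((Dh2 Dh *m w)^T *m Hh Mh *m p).
Proof.
move=> sbp pw pp; apply/eqP; rewrite -addr_eq0; apply/eqP.
rewrite trmx_mul -(mulmxA w^T (Dh2 Dh)^T) -mulmxDl -mulmxDr
  -[RHS](boundary_dir2_eq0 Mh pw pp).
rewrite /Dh2 trmx_tens !tensmx_mul mulmx1 trmx1 mul1mx -(sbp_mx sbp).
by congr (_ *m _ *m _); apply/matrixP => k l; rewrite !mxE mulrDr.
Qed.

(** * Limits of matrices through their entries *)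

Lemma cvg_mx {T : Type} {F : set_system T} {FF : Filter F} {R : realType}
    {m n : nat} (f : T -> 'M[R]_(m, n)) (A : 'M[R]_(m, n)) :
  (forall i j, f x i j @[x --> F] --> A i j)%classic ->
  (f x @[x --> F] --> A)%classic.
Proof.
(* A neighbourhood of A contains a box of entrywise neighbourhoods, and a filter is closed under the
   finite intersection over the entries. *)
move=> fA U [P nP sPU]; apply: (filterS (fun x => sPU (f x))).
by apply: filter_forall => i; apply: filter_forall => j; exact: fA.
Qed.

Lemma cvg_coord {T : Type} {F : set_system T} {FF : Filter F} {R : realType}
    {m n : nat} (f : T -> 'M[R]_(m, n)) (A : 'M[R]_(m, n)) i j :
  (f x @[x --> F] --> A)%classic -> (f x i j @[x --> F] --> A i j)%classic.
Proof. by move=> fA; exact: (cvg_comp _ _ fA (@coord_continuous R m n i j A)). Qed.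

Lemma cvg_mulmx {T : Type} {F : set_system T} {FF : Filter F} {R : realType}
    {m n k : nat} (f : T -> 'M[R]_(m, n)) (g : T -> 'M[R]_(n, k))
    (A : 'M[R]_(m, n)) (B : 'M[R]_(n, k)) :
  (f x @[x --> F] --> A)%classic -> (g x @[x --> F] --> B)%classic ->
  (f x *m g x @[x --> F] --> A *m B)%classic.
Proof.
move=> fA gB; apply: cvg_mx => i j; rewrite mxE.
under eq_fun do rewrite mxE.
apply: cvg_big => [|l _]; first exact: add_continuous.
by apply: cvgM; exact: cvg_coord.
Qed.

Lemma cvg_trmx {T : Type} {F : set_system T} {FF : Filter F} {R : realType}
    {m n : nat} (f : T -> 'M[R]_(m, n)) (A : 'M[R]_(m, n)) :
  (f x @[x --> F] --> A)%classic -> ((f x)^T @[x --> F] --> A^T)%classic.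
Proof.
move=> fA; apply: cvg_mx => i j; rewrite mxE; under eq_fun do rewrite mxE.
exact: cvg_coord.
Qed.

Lemma cvg_col_mx {T : Type} {F : set_system T} {FF : Filter F} {R : realType}
    {m1 m2 n : nat} (f : T -> 'M[R]_(m1, n)) (g : T -> 'M[R]_(m2, n))
    (A : 'M[R]_(m1, n)) (B : 'M[R]_(m2, n)) :
  (f x @[x --> F] --> A)%classic -> (g x @[x --> F] --> B)%classic ->
  (col_mx (f x) (g x) @[x --> F] --> col_mx A B)%classic.
Proof.
move=> fA gB; apply: cvg_mx => i j; rewrite -(splitK i).
case: (fintype.split i) => k; rewrite /= ?(col_mxEu, col_mxEd).
  by under eq_fun do rewrite col_mxEu; exact: cvg_coord.
by under eq_fun do rewrite col_mxEd; exact: cvg_coord.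
Qed.

(** * Derivatives relative to the half-line *)

Local Notation incr t := (within [set h | 0 <= t + h]%classic (0^')%classic).

(** Properness makes limits along [incr t] unique. It holds at t = 0 too, because small positive
    increments stay in the half-line. *)
Lemma incr_proper {R : realType} {t : R} : 0 <= t -> ProperFilter (incr t).
Proof.
move=> t0; apply: Build_ProperFilter_ex => P /nbhs_ballP[e /= e0 eP].
exists (e / 2); apply: eP; rewrite /= ?gt_eqF ?divr_gt0 //.
- by rewrite /ball /= sub0r normrN gtr0_norm ?divr_gt0 // ltr_pdivrMr // ltr_pMr // ltr1n.
- by rewrite addr_ge0 // divr_ge0 // ltW.
Qed.

(** Relational form of the derivative: it carries existence and value at once, so calculus rules
    need not mention [lim]. *)
Definition is_ddt {R : realType} {V : normedModType R} (f : R -> V) (t : R)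
  (l : V) := (diff_quot f t h @[h --> incr t] --> l)%classic.

Lemma is_ddt_derivable {R : realType} {V : normedModType R} (f : R -> V) t l :
  0 <= t -> is_ddt f t l -> derivable_ge0 f t /\ ddt f t = l.
Proof.
move=> t0 fl; have PF := incr_proper t0.
by split; [apply/cvg_ex; exists l | exact: (cvg_lim _ fl)].
Qed.

Lemma is_ddt_cvg {R : realType} {V : normedModType R} {f : R -> V} {t : R} {l : V} :
  0 <= t -> is_ddt f t l -> (f (t + h) @[h --> incr t] --> f t)%classic.
Proof.
move=> t0 fl; have PF := incr_proper t0.
have E h : f (t + h) = h *: diff_quot f t h + f t.
  (* The identity holds at h = 0 as well, so it can be rewritten under the binder for every h. *)
  have [->|h0] := eqVneq h 0; first by rewrite addr0 scale0r add0r.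
  by rewrite /diff_quot scalerA divff // scale1r subrK.
under eq_fun do rewrite E.
suff: (h *: diff_quot f t h + f t @[h --> incr t] --> 0 *: l + f t)%classic.
  by rewrite scale0r add0r.
apply: cvgD; last exact: cvg_cst.
(* The filter is the neighbourhood filter of 0 restricted twice, to h != 0 and to 0 <= t + h; both
   restrictions are dropped. *)
by apply: cvgZ fl; do 2! apply: cvg_within_filter; exact: cvg_id.
Qed.

(** Difference of two squares for a symmetric form: symmetry cancels the mixed terms. It writes the
    increment of a quadratic form as one product, with no second-order remainder. *)
Lemma quadratic_sub {R : comPzRingType} {n : nat} {A : 'M[R]_n} (x y : 'cV[R]_n) :
  A^T = A ->
  (x^T *m A *m x) 0 0 - (y^T *m A *m y) 0 0 = ((x + y)^T *m A *m (x - y)) 0 0.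
Proof.
move=> symA; have C : y^T *m A *m x = x^T *m A *m y.
  (* A 1 x 1 matrix equals its transpose. *)
  by rewrite [LHS]mx11_scalar -tr_scalar_mx -mx11_scalar !trmx_mul trmxK symA mulmxA.
rewrite [(_ + _)^T]linearD /= !mulmxDl !mulmxBr C.
by rewrite addrA subrK !mxE.
Qed.

(** The difference quotient is exactly (x(t+h) + x(t))^T A q(h), with q the quotient of x;
    continuity of x at t sends the first factor to 2 x(t)^T. *)
Lemma is_ddt_quadratic {R : realType} {n : nat} {A : 'M[R]_n}
    {x : R -> 'cV[R]_n} {t : R} {x' : 'cV[R]_n} :
  A^T = A -> 0 <= t -> is_ddt x t x' ->
  is_ddt (fun s => ((x s)^T *m A *m x s) 0 0 : R) t
    (2 * ((x t)^T *m A *m x') 0 0).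
Proof.
move=> symA t0 xx'; have PF := incr_proper t0.
have E : diff_quot (fun s => ((x s)^T *m A *m x s) 0 0 : R) t =
    fun h => ((x (t + h) + x t)^T *m A *m diff_quot x t h) 0 0.
  apply/funext => h; rewrite /diff_quot -scalemxAr [RHS]mxE.
  by rewrite -(quadratic_sub _ _ symA).
rewrite /is_ddt E.
have -> : 2 * ((x t)^T *m A *m x') 0 0 = ((x t + x t)^T *m A *m x') 0 0.
  by rewrite [(_ + _)^T]linearD /= !mulmxDl [RHS]mxE mulr_natl mulr2n.
apply: cvg_coord; apply: cvg_mulmx => //; apply: cvg_mulmx; last exact: cvg_cst.
apply: cvg_trmx; apply: cvgD; last exact: cvg_cst.
exact: is_ddt_cvg xx'.
Qed.

Lemma is_ddt_lin {R : realType} (c : R) {f g : R -> R} {t a b : R} :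
  0 <= t -> is_ddt f t a -> is_ddt g t b ->
  is_ddt (fun s => c * f s + c * g s) t (c * a + c * b).
Proof.
move=> t0 fa gb; have PF := incr_proper t0.
have E : diff_quot (fun s => c * f s + c * g s) t =
    fun h => c * diff_quot f t h + c * diff_quot g t h.
  apply/funext => h; rewrite /diff_quot /GRing.scale /= !(mulrCA c) -[RHS]mulrDr.
  by congr (_ * _); rewrite !mulrBr opprD addrACA.
by rewrite /is_ddt E; apply: cvgD; apply: cvgM => //; exact: cvg_cst.
Qed.

(** * Energy balance at a fixed time, with [p'] and [v'] in the role of the time derivatives *)

Lemma energy_rate_eq0 {R : realType} {N : nat}
    {D : 'M[R]_(N.+1, N.+2)} {Dh : 'M[R]_(N.+2, N.+1)}
    {M : 'M[R]_N.+1} {Mh : 'M[R]_N.+2}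
    {Jh : 'M[R]_(N.+2 * N.+2)}
    {J1 : 'M[R]_(N.+1 * N.+2)} {J2 : 'M[R]_(N.+2 * N.+1)}
    {G : 'M[R]_(N.+1 * N.+2 + N.+2 * N.+1)}
    {p p' : 'cV[R]_(N.+2 * N.+2)}
    {v1 : 'cV[R]_(N.+1 * N.+2)} {v2 : 'cV[R]_(N.+2 * N.+1)}
    {v' : 'cV[R]_(N.+1 * N.+2 + N.+2 * N.+1)} :
  sbp_operators D Dh M Mh -> is_diag_mx J1 -> is_diag_mx J2 -> G \in unitmx ->
  Jh *m p' + Dh1 Dh *m J1 *m v1 + Dh2 Dh *m J2 *m v2 = 0 ->
  v' + G *m col_mx (D1 D *m p) (D2 D *m p) = 0 ->
  periodic_metric J1 J2 -> periodic_solution p v1 v2 ->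
  p^T *m (Hh Mh *m Jh) *m p' +
  (col_mx v1 v2)^T *m (H M Mh *m block_mx J1 0 0 J2 *m invmx G) *m v' = 0.
Proof.
move=> sbp dJ1 dJ2 uG eqp eqv [pJ1 pJ2] [pp1 pp2 pv1 pv2].
have [[dM _] [dMh _] _] := sbp.
(* SBP is applied to the fluxes J v rather than to v, hence the use of the periodicity of the
   metric. *)
have pw1 : periodic_dir1 (fun k => (J1 *m v1) k 0).
  by move=> j; rewrite !mul_is_diagE // pJ1 pv1.
have pw2 : periodic_dir2 (fun k => (J2 *m v2) k 0).
  by move=> i; rewrite !mul_is_diagE // pJ2 pv2.
have -> : v' = - (G *m col_mx (D1 D *m p) (D2 D *m p)).
  by apply/eqP; rewrite -addr_eq0 eqv.
have {}eqp : Jh *m p' = - (Dh1 Dh *m (J1 *m v1) + Dh2 Dh *m (J2 *m v2)).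
  by apply/eqP; rewrite -addr_eq0 addrA !mulmxA eqp.
(* G^-1 cancels G; the diagonal blocks of H and J commute, so each J block can be moved by
   transposition onto its velocity component. *)
have -> : (col_mx v1 v2)^T *m (H M Mh *m block_mx J1 0 0 J2 *m invmx G) *m
    (- (G *m col_mx (D1 D *m p) (D2 D *m p))) =
    - ((J1 *m v1)^T *m (H1 M Mh *m D1 D) *m p +
       (J2 *m v2)^T *m (H2 M Mh *m D2 D) *m p).
  rewrite mulmxN !mulmxA mulmxKV //; congr (- _).
  rewrite -(mulmxA _ (H M Mh)) /H mulmx_block !(mul0mx, mulmx0, addr0, add0r).
  rewrite (diag_mxC (tensmx_is_diag dM dMh) dJ1).
  rewrite (diag_mxC (tensmx_is_diag dMh dM) dJ2).
  rewrite tr_col_mx mul_row_block !(mulmx0, addr0, add0r) mul_row_col.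
  by rewrite !trmx_mul (tr_is_diag dJ1) (tr_is_diag dJ2) !mulmxA.
rewrite (sbp_dir1 sbp pw1 pp1).
rewrite (sbp_dir2 sbp pw2 pp2).
(* With w1, w2 the discrete flux derivatives, SBP has turned the velocity part into (w1 + w2)^T Hh
   p, and the pressure equation turns the other part into - p^T Hh (w1 + w2). *)
rewrite -(mulmxA p^T) -mulmxA eqp !mulmxN !mulmxDr -(opprD _ (_^T *m _ *m p)) opprK.
set w1 := Dh1 Dh *m _; set w2 := Dh2 Dh *m _.
have C w : p^T *m (Hh Mh *m w) = w^T *m Hh Mh *m p.
  rewrite [LHS]mx11_scalar -tr_scalar_mx -mx11_scalar !trmx_mul trmxK.
  by rewrite (tr_is_diag (tensmx_is_diag dMh dMh)).
by rewrite !C addNr.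
Qed.

Theorem lemma1 (R : realType) (N : nat) (hN : (1 <= N)%N)
    (D : 'M[R]_(N.+1, N.+2)) (Dh : 'M[R]_(N.+2, N.+1))
    (M : 'M[R]_N.+1) (Mh : 'M[R]_N.+2)
    (hSBP : sbp_operators D Dh M Mh)
    (Jh : 'M[R]_(N.+2 * N.+2))
    (J1 : 'M[R]_(N.+1 * N.+2)) (J2 : 'M[R]_(N.+2 * N.+1))
    (hJh : pos_diag Jh) (hJ1 : pos_diag J1) (hJ2 : pos_diag J2)
    (G : 'M[R]_(N.+1 * N.+2 + N.+2 * N.+1))
    (hG : G \in unitmx)
    (hsym : H M Mh *m block_mx J1 0 0 J2 *m invmx G \is symmetricmx)
    (hpos : posdefmx (H M Mh *m block_mx J1 0 0 J2 *m invmx G))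
    (p : R -> 'cV[R]_(N.+2 * N.+2))
    (v1 : R -> 'cV[R]_(N.+1 * N.+2)) (v2 : R -> 'cV[R]_(N.+2 * N.+1))
    (hp : forall t : R, 0 <= t -> derivable_ge0 p t)
    (hv1 : forall t : R, 0 <= t -> derivable_ge0 v1 t)
    (hv2 : forall t : R, 0 <= t -> derivable_ge0 v2 t)
    (heq1 : forall t : R, 0 <= t ->
      Jh *m ddt p t + Dh1 Dh *m J1 *m v1 t + Dh2 Dh *m J2 *m v2 t = 0)
    (heq2 : forall t : R, 0 <= t ->
      ddt (fun s : R => col_mx (v1 s) (v2 s)) t
        + G *m col_mx (D1 D *m p t) (D2 D *m p t) = 0)
    (hmetric : periodic_metric J1 J2)
    (hsol : forall t : R, 0 <= t -> periodic_solution (p t) (v1 t) (v2 t)) :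
  let E : R -> R := fun t : R =>
    energy (Hh Mh) Jh (H M Mh) (block_mx J1 0 0 J2) G
      (p t) (col_mx (v1 t) (v2 t)) in
  forall t : R, 0 <= t -> derivable_ge0 E t /\ ddt E t = 0.
Proof.
move=> E t t0; have PF := incr_proper t0.
have [_ [dMh _] _] := hSBP.
have symp : (Hh Mh *m Jh)^T = Hh Mh *m Jh.
  have dH := tensmx_is_diag dMh dMh; have [dJ _] := hJh.
  by rewrite trmx_mul (tr_is_diag dH) (tr_is_diag dJ) [RHS](diag_mxC dH dJ).
have symv : (H M Mh *m block_mx J1 0 0 J2 *m invmx G)^T =
    H M Mh *m block_mx J1 0 0 J2 *m invmx G.
  (* [symmetricmx] is the Hermitian predicate with sign (-1)^0 and trivial conjugation, which
     reduces to equality with the transpose. *)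
  move/is_hermitianmxP: hsym => hsym.
  by rewrite [RHS]hsym expr0 scale1r map_mx_id.
(* Differentiability of the stacked vector makes the [ddt] in the velocity equation a genuine
   limit. *)
have dv : derivable_ge0 (fun s => col_mx (v1 s) (v2 s)) t.
  have Eq : diff_quot (fun s => col_mx (v1 s) (v2 s)) t =
      fun h => col_mx (diff_quot v1 t h) (diff_quot v2 t h).
    apply/funext => h; rewrite /diff_quot -scale_col_mx; congr (_ *: _).
    by rewrite opp_col_mx add_col_mx.
  rewrite /derivable_ge0 Eq; apply/cvg_ex.
  exists (col_mx (ddt v1 t) (ddt v2 t)).
  by apply: cvg_col_mx; [exact: hv1|exact: hv2].
apply: is_ddt_derivable => //.
have := energy_rate_eq0
  hSBP (proj1 hJ1) (proj1 hJ2) hG (heq1 t t0) (heq2 t t0) hmetric (hsol t t0).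
move=> /matrixP/(_ 0 0); rewrite mxE [RHS]mxE => rate0.
(* [derivable_ge0] unfolds to convergence to [ddt], hence to an instance of [is_ddt]. The factors 2
   from the quadratic forms then cancel the halves in the energy. *)
have := is_ddt_lin 2^-1 t0
  (is_ddt_quadratic symp t0 (hp t t0)) (is_ddt_quadratic symv t0 dv).
by rewrite -!mulrDr !mulKf ?pnatr_eq0 // rate0.
Qed.
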